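(* Let $\mathcal{L}=(L,\wedge,\vee,*,\rightarrowtail,0,1)$ be a BL-algebra and let $T_*$ be the topology on $L$ consisting of all $*$-open subsets of $L$. Then $(\mathcal{L},T_* )$ is a semitopological BL-algebra.
   Context: A BL-algebra is an algebra $\mathcal{L}=(L,\wedge,\vee,*,\rightarrowtail,0,1)$ of type $(2,2,2,2,0,0)$ such that: (BL1) $(L,\wedge,\vee,0,1)$ is a bounded lattice with greatest element $1$ and smallest element $0$; (BL2) $(L,*,1)$ is an Abelian monoid; (BL3) $c\le a\rightarrowtail b$ iff $c*a\le b$ for all $a,b,c\in L$; (BL4) $a\wedge b=a*(a\rightarrowtail b)$ for all $a,b\in L$; (BL5) $(a\rightarrowtail b)\vee(b\rightarrowtail a)=1$ for all $a,b\in L$. An element $a\in L$ is strongly less than $1$, written $a\ll 1$, if for every $b\in L$, $a\vee b=1$ implies $b=1$. Define $a\leftrightarrow b=(a\rightarrowtail b)*(b\rightarrowtail a)$ for $a,b\in L$. For $a,r\in L$ with $r\ll 1$, the $*$-ball is $B_r(a)=\{b\in L: a\leftrightarrow b>r\}$ (where $x>r$ means $r\le x$ and $r\neq x$). A subset $G\subseteq L$ is $*$-open if for every $a\in G$ there exists $r\in L$ with $r\ll 1$ and $B_r(a)\subseteq G$. The $*$-open subsets of $L$ form a topology $T_*$ on $L$. If $\tau$ is a topology on $L$, then $(\mathcal{L},\tau)$ is called a semitopological BL-algebra if for every $\square\in\{\wedge,\vee,*,\rightarrowtail\}$ and every $\delta\in L$ the maps $\square^\delta_l:(L,\tau)\to(L,\tau)$,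 $\square^\delta_l(x)=\delta\,\square\,x$, and $\square^\delta_r:(L,\tau)\to(L,\tau)$, $\square^\delta_r(x)=x\,\square\,\delta$, are continuous. *)

(* Defs.v *)
From HB Require Import structures.
From mathcomp Require Import all_boot all_order.
From mathcomp Require Import all_classical.
From mathcomp Require Import topology_structure.

Set Implicit Arguments.
Unset Strict Implicit.
Unset Printing Implicit Defensive.

Import Order.LTheory.
Local Open Scope order_scope.

Declare Scope bl_scope.
Delimit Scope bl_scope with BL.
Local Open Scope bl_scope.

(* The bounded lattice (L, meet, join, 0, 1) is the library's [tbLatticeType],
   with 0 = \bot and 1 = \top (possibly equal). Being a [choiceType] is no
   restriction on L in the presence of the axioms of [boolp]. *)
HB.mixin Record isBLAlgebra (d : Order.disp_t) L & Order.TBLattice d L := {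
  blmul : L -> L -> L;
  blres : L -> L -> L;
  blmulA : associative blmul;
  blmulC : commutative blmul;
  blmul1 : left_id \top blmul;
  blresP : forall a b c : L, (c <= blres a b) = (blmul c a <= b);
  bl_divisible : forall a b : L, Order.meet a b = blmul a (blres a b);
  bl_prelinear : forall a b : L, Order.join (blres a b) (blres b a) = \top
}.

#[short(type="blAlgebraType")]
HB.structure Definition BLAlgebra d :=
  { L of Order.TBLattice d L & isBLAlgebra d L }.

Notation "a * b" := (blmul a b) : bl_scope.
Notation "a ↣ b" := (blres a b) (at level 55, right associativity) : bl_scope.

Definition strongly_lt1 d (L : blAlgebraType d) (a : L) : Prop :=
  forall b : L, Order.join a b = \top -> b = \top.

Definition bleqv d (L : blAlgebraType d) (a b : L) : L := (a ↣ b) * (b ↣ a).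

Notation "a ↔* b" := (bleqv a b) (at level 60, no associativity) : bl_scope.

Definition star_ball d (L : blAlgebraType d) (r a : L) : set L :=
  [set b : L | r < (a ↔* b)].

Definition star_open d (L : blAlgebraType d) (G : set L) : Prop :=
  forall a : L, G a ->
    exists r : L, strongly_lt1 r /\ (star_ball r a `<=` G)%classic.

Lemma star_openT d (L : blAlgebraType d) : star_open [set: L]%classic.
Proof. by move=> a _; exists \bot; split=> // b; rewrite join0x. Qed.

Lemma star_openI d (L : blAlgebraType d) : setI_closed (@star_open d L).
Proof.
move=> G H oG oH a [/oG[r [r1 rG]] /oH[s [s1 sH]]].
exists (Order.join r s); split=> [b|b /= rsb].
  by rewrite -joinA => /r1/s1.
by split; [apply: rG|apply: sH]; apply: le_lt_trans rsb;
  rewrite ?leUl ?leUr.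
Qed.

Lemma star_open_bigU d (L : blAlgebraType d) (I : Type) (G : I -> set L) :
  (forall i, star_open (G i)) -> star_open (\bigcup_i G i)%classic.
Proof.
move=> oG a [i _ /oG[r [r1 rG]]].
by exists r; split=> // b /rG; exists i.
Qed.

(* The algebra and the topology need not be related. *)
#[short(type="topBLAlgebraType")]
HB.structure Definition TopBLAlgebra d :=
  { L of BLAlgebra d L & Topological L }.

Definition separately_continuous (T : topologicalType) (op : T -> T -> T) : Prop :=
  forall delta : T,
    continuous (fun x => op delta x) /\ continuous (fun x => op x delta).

Definition semitopological d (L : topBLAlgebraType d) : Prop :=
  [/\ separately_continuous (@Order.meet d L),
      separately_continuous (@Order.join d L),
      separately_continuous (@blmul d L)
    & separately_continuous (@blres d L)].

(* (L, T_* ): a copy of L with the same operations and the topology T_*. *)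
Definition star_topology d (L : blAlgebraType d) : Type := L.

HB.instance Definition _ d (L : blAlgebraType d) :=
  BLAlgebra.on (star_topology L).

HB.instance Definition _ d (L : blAlgebraType d) :=
  isOpenTopological.Build (star_topology L)
    (@star_openT d L) (@star_openI d L) (@star_open_bigU d L).

Lemma open_star_topologyE d (L : blAlgebraType d) (G : set (star_topology L)) :
  open G = star_open (G : set L).
Proof. by []. Qed.

(* Main.v *)
Require Import Defs.
From mathcomp Require Import all_boot all_order.
From mathcomp Require Import all_classical topology_structure.

(** Each of the translations f satisfies x ↔ y <= f x ↔ f y, and such a map
    sends the ball B_r(a) into B_r(f a) with the same radius r. *)

Import Order.LTheory.
Local Open Scope order_scope.
Local Open Scope bl_scope.

Section BLTheory.
Set Implicit Arguments.
Unset Strict Implicit.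
Context {d : Order.disp_t} {L : blAlgebraType d}.
Implicit Types x y z t : L.

(** The bound on [↔*] reduces to one on a single residuum: if [x ↣ y] lies below [f x ↣ f y] for all
    [x], [y] (or below [f y ↣ f x] when [f] reverses order), monotonicity of [*] lets this
    inequality and its mirror image be multiplied. For each translation the one-sided bound follows
    from residuation and modus ponens, and [star_continuous] turns the result into continuity. *)

Lemma bl_modus_ponens x y : (x ↣ y) * x <= y.
Proof. by rewrite -blresP. Qed.

Lemma blmul_le2r z x y : x <= y -> x * z <= y * z.
Proof. by move=> xy; rewrite -blresP (le_trans xy)// blresP. Qed.

Lemma blmul_le2 x y z t : x <= y -> z <= t -> x * z <= y * t.
Proof.
move=> xy zt; apply: (le_trans (blmul_le2r z xy)).
by rewrite blmulC [y * t]blmulC blmul_le2r.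
Qed.

Lemma blmul_leR x y : x * y <= y.
Proof. by rewrite -[leRHS]blmul1 blmul_le2r// lex1. Qed.

Lemma blres_meet2l z x y : x ↣ y <= Order.meet z x ↣ Order.meet z y.
Proof.
rewrite blresP lexI; apply/andP; split.
  exact: le_trans (blmul_leR _ _) (leIl _ _).
exact: le_trans (blmul_le2 (lexx _) (leIr _ _)) (bl_modus_ponens _ _).
Qed.

Lemma blres_join2l z x y : x ↣ y <= Order.join z x ↣ Order.join z y.
Proof.
(* Commuting the product lets residuation isolate the join on the left of [<=], where it splits into
   two bounds without distributing [*] over it. *)
rewrite blresP blmulC -blresP leUx !blresP; apply/andP; split.
  by apply: le_trans (leUl _ _); rewrite blmulC blmul_leR.
by apply: le_trans (leUr _ _); rewrite blmulC bl_modus_ponens.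
Qed.

Lemma blres_mul2l z x y : x ↣ y <= z * x ↣ z * y.
Proof.
rewrite blresP blmulA [_ * z]blmulC -blmulA.
exact: blmul_le2 (lexx _) (bl_modus_ponens _ _).
Qed.

Lemma blres_res2l z x y : x ↣ y <= (z ↣ x) ↣ (z ↣ y).
Proof.
rewrite !blresP -blmulA.
exact: le_trans (blmul_le2 (lexx _) (bl_modus_ponens _ _))
  (bl_modus_ponens _ _).
Qed.

Lemma blres_res2r z x y : x ↣ y <= (y ↣ z) ↣ (x ↣ z).
Proof.
rewrite !blresP [_ * (y ↣ z)]blmulC -blmulA.
exact: le_trans (blmul_le2 (lexx _) (bl_modus_ponens _ _))
  (bl_modus_ponens _ _).
Qed.

Lemma bleqvC x y : (x ↔* y) = (y ↔* x).
Proof. exact: blmulC. Qed.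

Lemma bleqv_homo (f : L -> L) :
  (forall x y, x ↣ y <= f x ↣ f y) ->
  forall x y, (x ↔* y) <= (f x ↔* f y).
Proof. by move=> fP x y; apply: blmul_le2. Qed.

(** An order-reversing map only exchanges the two factors of [↔*], which is symmetric. *)
Lemma bleqv_nhomo (f : L -> L) :
  (forall x y, x ↣ y <= f y ↣ f x) ->
  forall x y, (x ↔* y) <= (f x ↔* f y).
Proof. by move=> fP x y; rewrite [leRHS]bleqvC; apply: blmul_le2. Qed.

Lemma star_continuous (f : L -> L) :
  (forall x y, (x ↔* y) <= (f x ↔* f y)) ->
  continuous (f : star_topology L -> star_topology L).
Proof.
move=> fP; apply/continuousP => G; rewrite !open_star_topologyE => oG a.
move=> /oG[r [r1 rG]]; exists r; split=> // b rb.
(* The chain [r < (a ↔* b) <= (f a ↔* f b)] keeps the strict inequality that balls require. *)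
by apply: rG; apply: lt_le_trans (fP a b).
Qed.

Lemma star_separately_continuousC (op : L -> L -> L) :
  commutative op ->
  (forall z x y, x ↣ y <= op z x ↣ op z y) ->
  @separately_continuous (star_topology L) op.
Proof.
move=> opC opP z; split; apply: star_continuous; apply: bleqv_homo => x y //.
by rewrite ![op _ z]opC.
Qed.

End BLTheory.

Theorem theorem3p11 (d : Order.disp_t) (L : blAlgebraType d) :
  semitopological (star_topology L).
Proof.
split.
- exact: (star_separately_continuousC (@meetC _ L) blres_meet2l).
- exact: (star_separately_continuousC (@joinC _ L) blres_join2l).
- exact: (star_separately_continuousC (@blmulC _ L) blres_mul2l).
(* The residuum is not commutative: its left translations are handled by [bleqv_homo], its
   order-reversing right ones by [bleqv_nhomo]. *)
- move=> z; split; apply: (@star_continuous _ L).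
    exact/bleqv_homo/blres_res2l.
  exact/bleqv_nhomo/blres_res2r.
Qed.
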